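(* Let $X$ be a compact metric space, let $\phi$ be a continuous flow on $X$ with the oriented shadowing property, and let $\eta>0$. For every $0<\varepsilon<\eta/2$ there exist $0<\delta<\eta/2$ and $T>0$ such that every $\delta$-$T$-pseudo-orbit $P$ satisfying $d(\mathcal P(P),\operatorname{Sing}(\phi))>\eta$ is strongly $\varepsilon$-traced by some point of $X$.
   Context: $(X,d)$ is a compact metric space and $\phi$ a continuous flow on $X$. $\operatorname{Sing}(\phi)$ is the set of points fixed by all $\phi_t$. For sets, $d(A,B)=\inf\{d(a,b):a\in A,b\in B\}$; if $\operatorname{Sing}(\phi)=\emptyset$ the condition $d(\mathcal P(P),\operatorname{Sing}(\phi))>\eta$ is understood to hold. For $\delta,T>0$, a $\delta$-$T$-pseudo-orbit is a sequence $P=(x_i,t_i)_{i\in\mathbb Z}$ with $x_i\in X$, $t_i\ge T$ and $d(\phi_{t_i}(x_i),x_{i+1})\le\delta$ for all $i$. Put $\mathcal P(P)=\bigcup_{i\in\mathbb Z}\phi_{[0,t_i]}(x_i)$, $S_0=0$, $S_i=\sum_{n=0}^{i-1}t_n$ for $i>0$, and $S_i=-\sum_{n=1}^{|i|}t_{-n}$ for $i<0$. $\mathrm{Rep}$ is the set of increasing homeomorphisms $h:\mathbb R\to\mathbb R$ with $h(0)=0$; for $\varepsilon>0$, $\mathrm{Rep}(\varepsilon)=\{h\in\mathrm{Rep}: |\frac{h(t)-h(s)}{t-s}-1|\le\varepsilon \text{ for all } t\ne s\}$. The pseudo-orbit is $\varepsilon$-traced by $x\in X$ if there is $h\in\mathrm{Rep}$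 with $d(\phi_{t-S_i}(x_i),\phi_{h(t)}(x))\le\varepsilon$ for all $i\in\mathbb Z$ and $t\in[S_i,S_{i+1}]$; it is strongly $\varepsilon$-traced by $x$ if this holds with some $h\in\mathrm{Rep}(\varepsilon)$. The flow has the oriented shadowing property if for every $\varepsilon>0$ there is $\delta>0$ such that every $\delta$-$1$-pseudo-orbit is $\varepsilon$-traced by some point of $X$. *)

(* Defs.v *)
From mathcomp Require Import all_boot all_order all_algebra.
From mathcomp Require Import all_classical all_reals.
From mathcomp Require Import ereal topology normedtype.

Set Implicit Arguments.
Unset Strict Implicit.
Unset Printing Implicit Defensive.

Import Order.TTheory GRing.Theory Num.Theory.
Import numFieldNormedType.Exports.

Local Open Scope classical_set_scope.
Local Open Scope ring_scope.

Definition homeomorphism (T U : topologicalType) (f : T -> U) : Prop :=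
  continuous f /\ exists g : U -> T, [/\ cancel f g, cancel g f & continuous g].

Section Flows.
Variables (R : realType) (X : metricType R).

(* Continuity is joint in time and space. *)
Record continuous_flow (phi : R -> X -> X) : Prop := ContinuousFlow {
  flow_continuous : continuous (fun p : R * X => phi p.1 p.2);
  flow0 : forall x, phi 0 x = x;
  flowD : forall s t x, phi (s + t) x = phi s (phi t x)
}.

Definition Sing (phi : R -> X -> X) : set X :=
  [set x | forall t, phi t x = x].

(* The infimum is taken in the extended reals, so that it is [+oo] as soon as
   one of the two sets is empty. *)
Definition set_dist (A B : set X) : \bar R :=
  ereal_inf [set (mdist a b)%:E | a in A & b in B].

Definition pseudo_orbit (phi : R -> X -> X) (delta T : R)
    (P : int -> X * R) : Prop :=
  forall i : int,
    T <= (P i).2 /\ mdist (phi (P i).2 (P i).1) (P (i + 1)).1 <= delta.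

Definition trail (phi : R -> X -> X) (P : int -> X * R) : set X :=
  \bigcup_(i in [set: int]) [set phi t (P i).1 | t in `[0, (P i).2]].

(* [Negz n] is the integer [- n.+1]. *)
Definition jump_time (P : int -> X * R) (i : int) : R :=
  match i with
  | Posz n => \sum_(0 <= k < n) (P k%:Z).2
  | Negz n => - \sum_(1 <= k < n.+2) (P (- k%:Z)).2
  end.

Definition Rep : set (R -> R) :=
  [set h : R -> R | [/\ homeomorphism h, {homo h : s t / s < t} & h 0 = 0]].

Definition Rep_eps (eps : R) : set (R -> R) :=
  [set h : R -> R | Rep h /\
    forall s t, t != s -> `|(h t - h s) / (t - s) - 1| <= eps].

Definition traces_with (phi : R -> X -> X) (eps : R) (P : int -> X * R)
    (x : X) (h : R -> R) : Prop :=
  forall (i : int) (t : R), jump_time P i <= t <= jump_time P (i + 1) ->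
    mdist (phi (t - jump_time P i) (P i).1) (phi (h t) x) <= eps.

Definition traced (phi : R -> X -> X) (eps : R) (P : int -> X * R)
    (x : X) : Prop :=
  exists2 h, Rep h & traces_with phi eps P x h.

Definition strongly_traced (phi : R -> X -> X) (eps : R) (P : int -> X * R)
    (x : X) : Prop :=
  exists2 h, Rep_eps eps h & traces_with phi eps P x h.

Definition oriented_shadowing (phi : R -> X -> X) : Prop :=
  forall eps : R, 0 < eps -> exists2 delta : R, 0 < delta &
    forall P, pseudo_orbit phi delta 1 P -> exists x, traced phi eps P x.

End Flows.

(* Main.v *)
(* Trace the pseudo-orbit with a very small error by some [h] in [Rep]. The
   trail stays in the compact set [K] of points at distance at least [eta] from
   [Sing phi], and for small [g > 0] no point of [K] has period [g]. Hence, over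
   a time window of length [L], the drift [h (t + r) - h t - r] cannot reach
   [g] or [- g]: it is continuous in [r], vanishes at [r = 0], and a drift of
   exactly [g] would exhibit a point of [K] that [phi g] hardly moves. With
   [L = g / b] this says that [h t - t] is [b]-Lipschitz up to an additive error
   [g], so it is within [g] of a genuinely [b]-Lipschitz function [f] (an
   infimal convolution). Then [t + f t - f 0] is the required element of
   [Rep_eps], and it is so close to [h t] that the flow cannot tell. *)
Require Import Defs.
From mathcomp Require Import all_boot all_order all_algebra.
From mathcomp Require Import zify lra.
From mathcomp Require Import all_classical all_reals.
From mathcomp Require Import ereal topology normedtype.

Import Order.TTheory GRing.Theory Num.Theory.
Import numFieldNormedType.Exports.

Local Open Scope classical_set_scope.
Local Open Scope ring_scope.

(** * Uniform constants from compactness *)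

(** Asking for all small [e] at once makes the local hypothesis an eventual statement along [0^'+],
    so the near-covering form of compactness applies and no finite subcover is handled. *)
Lemma compact_uniform {R : realType} {M : pseudoMetricType R} (K : set M)
    (Q : R -> M -> Prop) : compact K ->
  (forall x, K x -> exists2 r : R, 0 < r &
     forall (e : R) (y : M), 0 < e <= r -> ball x r y -> Q e y) ->
  exists2 r : R, 0 < r & forall (e : R) (y : M), 0 < e <= r -> K y -> Q e y.
Proof.
move=> /compact_near_coveringP cK locQ.
have : \forall e \near 0^'+, K `<=` Q e.
  apply: (cK R (0:R)^'+ Q) => x /locQ[r r0 rQ].
  exists (ball x r, [set e | 0 < e <= r]) => /=; last first.
    by move=> [y e] /= [xy er]; exact: rQ.
  split; first exact: nbhsx_ballx.
  near=> e; apply/andP; split => //.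
  by near: e; exact: nbhs_right_le.
move=> [r /= r0 rQ]; exists (r / 2); first by rewrite divr_gt0.
move=> e y /andP[e0 er]; apply: rQ => //=.
by rewrite sub0r normrN gtr0_norm//; lra.
Unshelve. all: by end_near. Qed.

(** * Lipschitz functions on the line and reparametrizations *)

Lemma lipschitz_continuous {R : realType} (c : R) (f : R -> R) :
  (forall s t, `|f t - f s| <= c * `|t - s|) -> continuous f.
Proof.
move=> lipf s; apply/cvgrPdist_le => /= e e0.
have c0 : 0 < `|c| + 1 by rewrite ltr_wpDl.
near=> t.
rewrite (le_trans (lipf t s))// (@le_trans _ _ ((`|c| + 1) * `|s - t|))//.
  by rewrite ler_wpM2r// (le_trans (ler_norm c))// lerDl.
rewrite mulrC -ler_pdivlMr//; near: t.
by apply: cvgr_dist_le; [exact: cvg_id|rewrite divr_gt0].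
Unshelve. all: by end_near. Qed.

(** All slopes of [t + f t] are at least [1 - b > 0]: this yields strict monotonicity, surjectivity,
    and an inverse that is Lipschitz with constant [(1 - b)^-1]. *)
Lemma Rep_eps_lipschitz_perturbation {R : realType} (b : R) (f : R -> R) :
  b < 1 -> f 0 = 0 -> (forall s t, `|f t - f s| <= b * `|t - s|) ->
  Rep_eps b (fun t => t + f t).
Proof.
move=> b1 f0 lipf.
have incr s t : s < t -> (1 - b) * (t - s) <= (t + f t) - (s + f s).
  by move=> st; have := lipf s t; rewrite (gtr0_norm (_ : 0 < t - s)) ?subr_gt0//
    ler_norml => /andP[+ _]; lra.
have mono : {homo (fun t => t + f t) : s t / s < t}.
  move=> s t st; rewrite -subr_gt0 (lt_le_trans _ (incr _ _ st))//.
  by rewrite mulr_gt0// subr_gt0.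
have cts : continuous (fun t => t + f t).
  by move=> t; apply: cvgD; [exact: cvg_id|exact: lipschitz_continuous].
have b0 : 0 <= b.
  by have := le_trans (normr_ge0 _) (lipf 0 1); rewrite subr0 normr1 mulr1.
have surj y : exists x, x + f x = y.
  (* Since [f] is at most [b * m] in absolute value at [m] and [- m], the values of [t + f t] there
     enclose the interval from [- (1 - b) * m] to [(1 - b) * m], which contains [y]. *)
  pose m := `|y| / (1 - b).
  have m0 : 0 <= m by rewrite divr_ge0// subr_ge0 ltW.
  have ym : (1 - b) * m = `|y| by rewrite mulrC divfK// subr_eq0 gt_eqF.
  have fm : `|f m| <= b * m by have := lipf 0 m; rewrite f0 !subr0 (ger0_norm m0).
  have fNm : `|f (- m)| <= b * m.
    by have := lipf 0 (- m); rewrite f0 !subr0 normrN (ger0_norm m0).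
  have [| | |x _ <-] := @IVT R (fun t => t + f t) (- m) m y; last by exists x.
  - lra.
  - exact: continuous_subspaceT.
  - move: fm fNm (ler_norm y) (ler_norm (- y)); rewrite normrN -ym !ler_norml.
    move=> /andP[h1 h2] /andP[h3 h4] h5 h6.
    by rewrite ge_min le_max; apply/andP; split; apply/orP; [left|right]; lra.
have [k kf] := choice surj.
have inj : injective (fun t => t + f t).
  move=> s t /= st; case: (ltgtP s t) => // /mono; by rewrite st ltxx.
split; first split => //.
- split=> //; exists k; split=> // [x|].
    by apply: inj; rewrite /= kf.
  apply: (@lipschitz_continuous _ (1 - b)^-1) => s t.
  wlog kst : s t / k s < k t.
    move=> H; case: (ltgtP (k s) (k t)) => [|/H|->]; first exact: H.
      by rewrite distrC (distrC s).
    by rewrite subrr normr0 mulr_ge0// invr_ge0 subr_ge0 ltW.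
  rewrite mulrC ler_pdivlMr ?subr_gt0// mulrC.
  have := incr _ _ kst; rewrite !kf => /le_trans; rewrite gtr0_norm ?subr_gt0//.
  by apply; exact: ler_norm.
- by rewrite f0 addr0.
- move=> s t ts.
  have ts0 : t - s != 0 by rewrite subr_eq0.
  have -> : (t + f t - (s + f s)) / (t - s) - 1 = (f t - f s) / (t - s).
    by rewrite (_ : _ - (s + f s) = (t - s) + (f t - f s));
      [rewrite mulrDl divff// addrC addKr|lra].
  by rewrite normrM normfV ler_pdivrMr ?normr_gt0// lipf.
Qed.

(** Cut the interval into steps of length [L]: each full step costs at most [c <= b * L], and the
    additive [c] is paid only once, for the last step. *)
Lemma coarse_lipschitz {R : realType} (L b c : R) (g : R -> R) :
  0 < L -> 0 <= b -> c <= b * L ->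
  (forall s r, 0 <= r <= L -> `|g (s + r) - g s| <= c) ->
  forall s t, `|g t - g s| <= b * `|t - s| + c.
Proof.
move=> L0 b0 cL gL s t.
wlog st : s t / s <= t.
  move=> H; have [/H//|/ltW/H] := leP s t.
  by rewrite distrC (distrC s).
have [n] : exists n : nat, t - s <= n%:R * L.
  exists (Num.bound (`|t - s| / L)); rewrite -ler_pdivrMr//.
  have q0 : 0 <= `|t - s| / L by rewrite divr_ge0// ltW.
  apply: le_trans (ltW (archi_boundP q0)).
  by rewrite ler_pM2r ?invr_gt0// ler_norm.
rewrite (ger0_norm (_ : 0 <= t - s)) ?subr_ge0//.
elim: n s st => [|n IH] s st; rewrite ?mul0r => tsn; first last.
  have [tsL|Lts] := leP (t - s) L.
    have := gL s (t - s); rewrite subrKC tsL subr_ge0 st => /(_ isT) /le_trans.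
    by apply; rewrite lerDr mulr_ge0// subr_ge0.
  have := IH (s + L) ltac:(lra).
  rewrite -natr1 mulrDl mul1r in tsn.
  move=> /(_ ltac:(lra)) h1.
  have := gL s L; rewrite lexx ltW// => /(_ isT) h2.
  have -> : g t - g s = (g t - g (s + L)) + (g (s + L) - g s) by lra.
  rewrite (le_trans (ler_normD _ _))//.
  have := lerD h1 h2; lra.
have -> : t = s by lra.
have := gL s 0; rewrite addr0 !subrr normr0 mulr0 add0r.
by apply; rewrite lexx ltW.
Qed.

(** The infimum over [s] of [g s + b * |t - s|] is [b]-Lipschitz in [t]. The choice [s = t] puts it
    below [g t], and the hypothesis keeps every competitor above [g t - c]. *)
Lemma lipschitz_approximation {R : realType} (b c : R) (g : R -> R) :
  0 <= b -> (forall s t, `|g t - g s| <= b * `|t - s| + c) ->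
  exists f : R -> R, (forall s t, `|f t - f s| <= b * `|t - s|) /\
    (forall t, g t - c <= f t <= g t).
Proof.
move=> b0 gbc.
pose A t := [set g s + b * `|t - s| | s in [set: R]].
pose f t := inf (A t).
have A0 t : A t !=set0 by exists (g 0 + b * `|t - 0|), 0.
have Alb t : lbound (A t) (g t - c).
  by move=> _ [s _ <-]; have := gbc s t; rewrite ler_norml => /andP[_]; lra.
have fle t s : f t <= g s + b * `|t - s|.
  by apply: ge_inf; [exists (g t - c); exact: Alb|exists s].
have flip s t : f t - f s <= b * `|t - s|.
  rewrite lerBlDr -lerBlDl; apply: lb_le_inf => // _ [u _ <-].
  rewrite lerBlDl (le_trans (fle t u))// addrCA lerD2l -mulrDr ler_wpM2l//.
  exact: ler_distD.
exists f; split=> [s t|t].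
  by rewrite ler_norml flip andbT lerNl opprB distrC flip.
apply/andP; split; first exact: lb_le_inf.
by rewrite (le_trans (fle t t))// subrr normr0 mulr0 addr0.
Qed.

(** * Uniform continuity of the flow *)

Lemma flow_near {R : realType} {X : metricType R} (phi : R -> X -> X)
    (t : R) (x : X) (e : R) : continuous_flow phi -> 0 < e ->
  exists2 r : R, 0 < r & forall s y, `|t - s| < r -> mdist x y < r ->
    mdist (phi t x) (phi s y) < e.
Proof.
move=> [cphi _ _] e0.
have := cphi (t, x) _ (nbhsx_ballx (phi t x) e e0).
move=> /nbhs_ballP[r /= r0 rphi]; exists r => // s y tsr xyr.
have := rphi (s, y); rewrite ballEmdist/=; apply.
by split => //=; rewrite ballEmdist.
Qed.

Lemma flow_equicontinuous {R : realType} {X : metricType R}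
    (phi : R -> X -> X) (L e : R) :
  compact [set: X] -> continuous_flow phi -> 0 < e ->
  exists2 r : R, 0 < r & forall s x y, `|s| <= L -> mdist x y <= r ->
    mdist (phi s x) (phi s y) <= e.
Proof.
move=> cX phiP e0.
have cK := compact_setX (@segment_compact R (- L) L) cX.
have [|r r0 rphi] := @compact_uniform R _ _
    (fun r (p : R * X) => forall y, mdist p.2 y <= r ->
       mdist (phi p.1 p.2) (phi p.1 y) <= e) cK; last first.
  exists r => // s x y sL xy.
  apply: (rphi r (s, x)); rewrite ?r0 ?lexx//=.
  by split => //=; rewrite in_itv/= -ler_norml.
move=> [s x] _; have e20 : 0 < e / 2 by rewrite divr_gt0.
have [r r0 rphi] := flow_near phi s x _ phiP e20.
(* Half of [r], because [y] is close to [x'], which is itself only close to the centre [x]. *)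
exists (r / 2); first by rewrite divr_gt0.
move=> d [s' x'] /andP[d0 dr] [/= ss' xx'] y x'y.
rewrite ballEmdist /= in xx'.
have {}ss' : `|s - s'| < r by apply: lt_trans ss' _; lra.
have xy : mdist x y < r by have := metric_triangle x x' y; lra.
have := rphi _ _ ss' xy; have := rphi s' x' ss' ltac:(lra).
have := metric_triangle (phi s' x') (phi s x) (phi s' y).
by rewrite (metric_sym _ (phi s x)); lra.
Qed.

Lemma flow_short_time {R : realType} {X : metricType R}
    (phi : R -> X -> X) (e : R) :
  compact [set: X] -> continuous_flow phi -> 0 < e ->
  exists2 r : R, 0 < r &
    forall s x, `|s| <= r -> mdist (phi s x) x <= e.
Proof.
move=> cX phiP e0.
have [|r r0 rphi] := @compact_uniform R X _
    (fun r x => forall s, `|s| <= r -> mdist (phi s x) x <= e) cX; last first.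
  by exists r => // s x; apply: rphi; rewrite // r0 lexx.
move=> x _; have e20 : 0 < e / 2 by rewrite divr_gt0.
have [r r0 rphi] := flow_near phi 0 x _ phiP e20.
exists (Num.min (r / 2) (e / 2)); first by rewrite lt_min !divr_gt0.
move=> d y /andP[d0]; rewrite le_min ballEmdist/= lt_min.
move=> /andP[dr _] /andP[xyr xye] s sd.
have := rphi s y; rewrite sub0r normrN => /(_ ltac:(lra) ltac:(lra)).
have := metric_triangle (phi s y) x y.
by rewrite (flow0 phiP) (metric_sym _ x); lra.
Qed.

(** * Periods and displacements away from fixed points *)

Lemma flow_period {R : realType} {X : metricType R} (phi : R -> X -> X)
    (g : R) (x : X) (k : int) : continuous_flow phi -> phi g x = x ->
  phi (k%:~R * g) x = x.
Proof.
move=> phiP gx.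
have nat_period n : phi (n%:R * g) x = x.
  elim: n => [|n IH]; first by rewrite mul0r (flow0 phiP).
  by rewrite -natr1 mulrDl mul1r (flowD phiP) gx.
case: k => n; first exact: nat_period.
rewrite NegzE mulrNz mulNr -{1}(nat_period n.+1) -(flowD phiP).
by rewrite addNr (flow0 phiP).
Qed.

(** A very short period keeps the whole orbit near its starting point. If [phi t] moves [x] by [d],
    a point [y] near [x] with short period would have [phi t x] within [d / 2] of [y], and [y]
    within [d / 2] of [x]. *)
Lemma no_short_period {R : realType} {X : metricType R} (phi : R -> X -> X)
    (K : set X) : continuous_flow phi -> compact K ->
  (forall x, K x -> ~ Sing phi x) ->
  exists2 r : R, 0 < r & forall g x, 0 < g <= r -> K x -> phi g x <> x.
Proof.
move=> phiP cK KS.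
apply: (@compact_uniform R X K (fun g x => phi g x <> x)) => // x /KS.
move=> /existsNP[t /eqP]; rewrite -mdist_gt0.
set d := mdist _ _ => d0; have d20 : 0 < d / 2 by rewrite divr_gt0.
have [r r0 rphi] := flow_near phi t x _ phiP d20.
exists (Num.min r (d / 2)); first by rewrite lt_min r0.
move=> g y /andP[g0]; rewrite le_min ballEmdist/= lt_min.
move=> /andP[gr _] /andP[xyr xyd] gy.
(* [t] is within [g] of a multiple of the period [g]. *)
have /andP[k1 k2] := floor_itv (t / g).
set k := Num.floor _ in k1 k2.
rewrite ler_pdivlMr// in k1.
rewrite ltr_pdivrMr// intrD mulrDl mul1r in k2.
have := rphi (k%:~R * g) y.
rewrite (flow_period phi g y k phiP gy) ger0_norm ?subr_ge0//.
move=> /(_ ltac:(lra) xyr) h.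
by have := metric_triangle (phi t x) y x; rewrite -/d (metric_sym y); lra.
Qed.

(** The moved point [y] is only near [K], as a tracing orbit will be. The sign of [g] is free, so
    that the bound serves both [g] and [- g]. *)
Lemma displacement_bound {R : realType} {X : metricType R}
    (phi : R -> X -> X) (K : set X) (g : R) :
  continuous_flow phi -> compact K -> (forall x, K x -> phi g x <> x) ->
  exists2 r : R, 0 < r & forall x y, K x -> mdist x y <= r ->
    r < mdist x (phi g y).
Proof.
move=> phiP cK Kg.
have [|r r0 rphi] := @compact_uniform R X K
    (fun r x => forall y, mdist x y <= r -> r < mdist x (phi g y)) cK; last first.
  by exists r => // x y Kx; apply: (rphi r x) => //; rewrite r0 lexx.
move=> x /Kg /eqP; rewrite -mdist_gt0; set d := mdist _ _ => d0.
(* Replacing [x] by [z] and [phi g x] by [phi g y] loses at most [d / 4] each, which leaves more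
   than [d / 4]. *)
have d40 : 0 < d / 4 by rewrite divr_gt0.
have [r r0 rphi] := flow_near phi g x _ phiP d40.
exists (Num.min (r / 2) (d / 4)); first by rewrite lt_min !divr_gt0.
move=> e z /andP[e0]; rewrite le_min ballEmdist/= lt_min.
move=> /andP[er ed] /andP[xzr xzd] y zy.
have := rphi g y; rewrite subrr normr0 => /(_ r0).
have := metric_triangle x z y; have := metric_triangle x z (phi g y).
have := metric_triangle (phi g x) (phi g y) x.
rewrite -/d (metric_sym _ x); lra.
Qed.

(** * Pseudo-orbits in real time and the drift of a tracing *)

Lemma jump_timeS {R : realType} {X : metricType R} (P : int -> X * R)
    (i : int) : jump_time P (i + 1) = jump_time P i + (P i).2.
Proof.
case: i => [n|[|n]].
- by rewrite -PoszD addn1 /jump_time big_nat_recr.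
(* From index [-1] to [0], where [jump_time] changes branch. *)
- by rewrite /= big_geq// big_nat1 addNr.
- rewrite (_ : Negz n.+1 + 1 = Negz n); last by rewrite !NegzE; lia.
  rewrite /jump_time [in RHS]big_nat_recr//= -NegzE opprD.
  by rewrite -addrA addNr addr0.
Qed.

Lemma jump_time_le {R : realType} {X : metricType R} (P : int -> X * R)
    (i j : int) : (forall k, 0 <= (P k).2) -> i <= j ->
  jump_time P i <= jump_time P j.
Proof.
move=> P0 ij; have -> : j = i + `|j - i|%N by lia.
elim: `|_|%N => [|n IH]; first by rewrite addr0.
by rewrite -addn1 PoszD addrA jump_timeS (le_trans IH)// lerDl.
Qed.

(** Gaps of at least [T] send the jump times to both infinities; walking up from index [- N], at
    most [N + N] steps reach the interval of [t]. *)
Lemma jump_time_index {R : realType} {X : metricType R} (P : int -> X * R)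
    (T t : R) : 0 < T -> (forall k, T <= (P k).2) ->
  exists i, jump_time P i <= t < jump_time P (i + 1).
Proof.
move=> T0 PT.
have lb (i : int) n : jump_time P i + n%:R * T <= jump_time P (i + n%:Z).
  elim: n => [|n IH]; first by rewrite mul0r !addr0.
  rewrite -addn1 PoszD addrA jump_timeS natrD mulrDl mul1r.
  by have := PT (i + n%:Z); lra.
pose N := Num.bound (`|t| / T).
have Nt : `|t| < N%:R * T.
  by rewrite -ltr_pdivrMr// archi_boundP// divr_ge0// ltW.
have S0 : jump_time P 0 = 0 by rewrite /= big_geq.
have lo : jump_time P (- N%:Z) <= t.
  have := lb (- N%:Z) N; rewrite addNr S0.
  by have := ler_norm (- t); rewrite normrN; lra.
have hi : t < jump_time P (- N%:Z + (N + N)%N%:Z).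
  rewrite PoszD addKr; have := lb 0 N; rewrite add0r S0.
  by have := ler_norm t; lra.
elim: (N + N)%N (- N%:Z) lo hi => [|n IH] i lo hi.
  by rewrite addr0 in hi; have := le_lt_trans lo hi; rewrite ltxx.
have [lt|ge] := ltP t (jump_time P (i + 1)); first by exists i; rewrite lo lt.
by apply: IH ge _; rewrite -addrA -PoszD add1n.
Qed.

(* If [h r - h t] ever differed from [r - t] by exactly [g], then some point
   of [K] would be moved by less than [c] under time [g] or [- g]. *)
Lemma tracing_drift {R : realType} {X : metricType R} (phi : R -> X -> X)
    (K : set X) (L g c e : R) (y : R -> X) (x : X) (h : R -> R) :
  continuous_flow phi -> 0 < g ->
  (forall w z, K w -> mdist w z <= c ->
     c < mdist w (phi g z) /\ c < mdist w (phi (- g) z)) ->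
  e <= c ->
  (forall s a b, `|s| <= L -> mdist a b <= e ->
     mdist (phi s a) (phi s b) <= c / 2) ->
  (forall t, K (y t)) ->
  (forall t s, 0 <= s <= L -> mdist (phi s (y t)) (y (t + s)) <= c / 2) ->
  continuous h -> (forall t, mdist (y t) (phi (h t) x) <= e) ->
  forall t r, 0 <= r <= L -> `|h (t + r) - h t - r| <= g.
Proof.
move=> phiP g0 disp ec equi Ky dy ch yh t r /andP[r0 rL].
have avoid s : 0 <= s <= L ->
    h (t + s) - h t - s <> g /\ h (t + s) - h t - s <> - g.
  move=> /[dup] sL /andP[s0 sL'].
  (* One half of [c] pays for the jumps of [y] over the window, the other for the tracing error at
     time [t] carried along by [phi s]. *)
  have near_s : mdist (y (t + s)) (phi s (phi (h t) x)) <= c.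
    have := equi s _ _ ltac:(by rewrite ger0_norm) (yh t).
    have := dy t s sL; rewrite (metric_sym (phi s (y t))).
    by have := metric_triangle (y (t + s)) (phi s (y t)) (phi s (phi (h t) x)); lra.
  have [d1 d2] := disp _ _ (Ky (t + s)) near_s.
  rewrite -!(flowD phiP) in d1 d2; have yhs := yh (t + s).
  split=> hE.
    by move: d1; rewrite (_ : g + s + h t = h (t + s)); [lra|rewrite -hE; lra].
  by move: d2; rewrite (_ : - g + s + h t = h (t + s)); [lra|rewrite -hE; lra].
have cf : {within `[0, r], continuous (fun s => h (t + s) - h t - s)}.
  apply: continuous_subspaceT => s; apply: cvgB; last exact: cvg_id.
  apply: cvgB; last exact: cvg_cst.
  apply: (@continuous_comp _ _ _ (fun s => t + s) h); last exact: ch.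
  by apply: cvgD; [exact: cvg_cst|exact: cvg_id].
have ivt v : Num.min 0 (h (t + r) - h t - r) <= v
    <= Num.max 0 (h (t + r) - h t - r) ->
    exists2 s, 0 <= s <= L & h (t + s) - h t - s = v.
  move=> vP; have [|s] := IVT r0 cf (v := v); first by rewrite addr0 subrr subr0.
  rewrite in_itv/= => /andP[s0 sr] <-; exists s => //.
  by rewrite s0 (le_trans sr).
rewrite leNgt; apply/negP; rewrite ltr_normr.
move=> /orP[lt|lt]; last first.
- have [|s /avoid[_]] := ivt (- g); last by [].
  by rewrite ge_min le_max; apply/andP; split; apply/orP; [right|left]; lra.
- have [|s /avoid[+ _]] := ivt g; last by [].
  by rewrite ge_min le_max; apply/andP; split; apply/orP; [left|right]; lra.
Qed.

(** Every piece lasts at least [T], so a window of length at most [T] crosses at most one jump. Past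
    that jump, both curves are images of its two ends [a] and [b] under the same [phi u], with [u]
    the time elapsed since the jump. *)
Lemma pseudo_orbit_function {R : realType} {X : metricType R}
    (phi : R -> X -> X) (delta T : R) (P : int -> X * R) :
  continuous_flow phi -> 0 < T -> pseudo_orbit phi delta T P ->
  exists y : R -> X,
    (forall t, exists i, [/\ y t = phi (t - jump_time P i) (P i).1 &
       jump_time P i <= t <= jump_time P (i + 1)]) /\
    (forall t s, 0 <= s <= T ->
       y (t + s) = phi s (y t) \/
       exists u a b, [/\ 0 <= u <= s, mdist a b <= delta,
         phi s (y t) = phi u a & y (t + s) = phi u b]).
Proof.
move=> phiP T0 PP; have PT k : T <= (P k).2 by have [] := PP k.
have [i iP] := choice (fun t => jump_time_index P T t T0 PT).
have P0 k : 0 <= (P k).2 by rewrite (le_trans (ltW T0)).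
exists (fun t => phi (t - jump_time P (i t)) (P (i t)).1); split=> [t|t s].
  by exists (i t); split=> //; have /andP[-> /ltW] := iP t.
move=> /andP[s0 sT]; set j := i (t + s); set k := i t.
have /andP[j1 j2] : jump_time P j <= t + s < jump_time P (j + 1) by exact: iP.
have /andP[k1 k2] : jump_time P k <= t < jump_time P (k + 1) by exact: iP.
have kj : k <= j.
  rewrite leNgt; apply/negP => jk.
  have := jump_time_le P (j + 1) k P0 ltac:(lia); lra.
(* Otherwise all of piece [k + 1] would fit between [t] and [t + s], giving [T < s]. *)
have jk : j <= k + 1.
  rewrite leNgt; apply/negP => kj'.
  have := jump_time_le P (k + 1 + 1) j P0 ltac:(lia).
  by rewrite jump_timeS; have := PT (k + 1); lra.
have [->|jE] : j = k \/ j = k + 1 by lia.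
  by left; rewrite -(flowD phiP); congr phi; lra.
right; exists (t + s - jump_time P j), (phi (P k).2 (P k).1), (P j).1.
rewrite -!(flowD phiP) jE; split=> //.
- by rewrite -jE subr_ge0 j1/= jE; lra.
- by have [] := PP k.
- by rewrite jump_timeS; congr phi; lra.
Qed.

(** * Choice of the constants and conclusion *)

Lemma compact_far {R : realType} {X : metricType R} (S : set X) (d : R) :
  compact [set: X] -> compact [set x | forall s, S s -> d <= mdist x s].
Proof.
move=> cX; apply: subclosed_compact cX _ => // x clx s Ss /=.
rewrite leNgt; apply/negP => xs.
have r0 : 0 < d - mdist x s by rewrite subr_gt0.
have [y [/(_ s Ss) ys]] := clx _ (nbhsx_ballx x _ r0).
by rewrite ballEmdist/=; have := metric_triangle y x s; rewrite (metric_sym y x); lra.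
Qed.

Theorem theorem4p4 (R : realType) (X : metricType R)
    (X_compact : compact [set: X]) (phi : R -> X -> X)
    (phi_flow : continuous_flow phi) (phi_shadowing : oriented_shadowing phi)
    (eta : R) (eta_gt0 : 0 < eta) :
  forall eps : R, 0 < eps < eta / 2 ->
  exists delta T : R, [/\ 0 < delta < eta / 2, 0 < T &
    forall P : int -> X * R, pseudo_orbit phi delta T P ->
      (eta%:E < set_dist (trail phi P) (Sing phi))%E ->
      exists x : X, strongly_traced phi eps P x].
Proof.
move=> eps /andP[eps0 _].
pose K := [set x : X | forall s, Sing phi s -> eta <= mdist x s].
have cK : compact K by exact: compact_far.
have KS x : K x -> ~ Sing phi x.
  by move=> Kx /Kx; rewrite mdistxx; lra.
have eps20 : 0 < eps / 2 by rewrite divr_gt0.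
have [p p0 period] := no_short_period phi K phi_flow cK KS.
have [q q0 short] := flow_short_time phi (eps / 2) X_compact phi_flow eps20.
(* [p] excludes the period [g] on [K]; [q] makes a time error of [g] cost at most [eps / 2]. *)
pose g := Num.min p q.
have g0 : 0 < g by rewrite lt_min p0.
have gp : g <= p by rewrite ge_min lexx.
have gq : g <= q by rewrite ge_min lexx orbT.
have fix_g x : K x -> phi g x <> x by apply: period; rewrite g0.
have fix_Ng x : K x -> phi (- g) x <> x.
  by move=> /fix_g + Ngx; rewrite -{1}Ngx -(flowD phi_flow) subrr (flow0 phi_flow).
have [c1 c10 disp1] := displacement_bound phi K g phi_flow cK fix_g.
have [c2 c20 disp2] := displacement_bound phi K (- g) phi_flow cK fix_Ng.
pose c := Num.min c1 c2.
have c0 : 0 < c by rewrite lt_min c10.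
have cc1 : c <= c1 by rewrite ge_min lexx.
have cc2 : c <= c2 by rewrite ge_min lexx orbT.
have disp w z : K w -> mdist w z <= c ->
    c < mdist w (phi g z) /\ c < mdist w (phi (- g) z).
  move=> Kw wz; have := disp1 w z Kw ltac:(lra).
  by have := disp2 w z Kw ltac:(lra); split; lra.
(* [eps] bounds the slopes as [Rep_eps] demands; [1 / 2] keeps [b] below 1. *)
pose b := Num.min eps (1 / 2).
have b0 : 0 < b by rewrite lt_min eps0; lra.
have b_eps : b <= eps by rewrite ge_min lexx.
have b1 : b < 1 by rewrite gt_min; apply/orP; right; lra.
pose L := g / b.
have L0 : 0 < L by rewrite divr_gt0.
have c20' : 0 < c / 2 by rewrite divr_gt0.
have [e1 e10 equi] := flow_equicontinuous phi L (c / 2) X_compact phi_flow c20'.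
pose e := Num.min e1 (Num.min c (eps / 2)).
have e0 : 0 < e by rewrite lt_min e10 lt_min c0.
have : e <= Num.min e1 (Num.min c (eps / 2)) by exact: lexx.
rewrite le_min => /andP[ee1].
rewrite le_min => /andP[ec eeps].
have [d1 d10 shadow] := phi_shadowing e e0.
(* [d1] gives the tracing, [e1] keeps one jump within [c / 2] over times up to [L], and [eta / 4]
   ensures [delta < eta / 2]. *)
pose delta := Num.min d1 (Num.min e1 (eta / 4)).
have : delta <= Num.min d1 (Num.min e1 (eta / 4)) by exact: lexx.
rewrite le_min => /andP[dd1]; rewrite le_min => /andP[de1 deta].
(* At least 1 for the shadowing property, at least [L] so that a drift window meets at most one
   jump. *)
have [T1 TL] : 1 <= Num.max 1 L /\ L <= Num.max 1 L.
  by split; rewrite le_max lexx ?orbT.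
exists delta, (Num.max 1 L); split; [|lra|].
  by rewrite !lt_min d10 e10/=; apply/andP; split; lra.
move=> P PP far.
have T0 : 0 < Num.max 1 L by lra.
have [|x [h [[ch _] hincr h0] trh]] := shadow P.
  by move=> i; have [? ?] := PP i; split; lra.
exists x.
have [y [yP dy]] := pseudo_orbit_function phi delta _ P phi_flow T0 PP.
have Ky t : K (y t).
  have [i [-> /andP[i1 i2]]] := yP t; move=> s Ss.
  rewrite -lee_fin (le_trans (ltW far))//; apply: ereal_inf_lbound.
  exists (phi (t - jump_time P i) (P i).1); last by exists s.
  exists i => //; exists (t - jump_time P i) => //=.
  by rewrite in_itv/=; rewrite jump_timeS in i2; apply/andP; split; lra.
have yh t : mdist (y t) (phi (h t) x) <= e.
  by have [i [-> ti]] := yP t; exact: trh.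
have drift := tracing_drift phi K L g c e y x h phi_flow g0 disp ec.
have {}drift t r : 0 <= r <= L -> `|h (t + r) - h t - r| <= g.
  apply: drift => // [s u v sL uv|s u /andP[u0 uL]].
    by apply: equi => //; lra.
  have [|->|] := dy s u; rewrite ?u0 ?mdistxx; try lra.
  move=> [u' [v [w [/andP[u'0 u'u] vw -> ->]]]].
  by apply: equi; rewrite ?ger0_norm//; lra.
have bL : g <= b * L by rewrite mulrC divfK// gt_eqF.
have [|f [lipf fh]] := @lipschitz_approximation R b g (fun t => h t - t) (ltW b0).
  apply: (@coarse_lipschitz R L) => // [|s r sr]; first exact: ltW.
  have := drift s r sr; rewrite (_ : h (s + r) - h s - r = h (s + r) - (s + r) - (h s - s))//; lra.
exists (fun t => t + (f t - f 0)).
  have [||rep slope] := @Rep_eps_lipschitz_perturbation R b (fun t => f t - f 0) b1.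
  - by rewrite subrr.
  - by move=> s t; rewrite [X in `|X|](_ : _ = f t - f s)//; lra.
  - by split=> // s t ts; apply: le_trans b_eps; exact: slope.
move=> i t ti; set k := t + (f t - f 0).
(* [h t - t - f t] lies in [[0, g]] and [f 0] in [[- g, 0]], so their sum [h t - k] costs only [g],
   not [2 g]. *)
have kh : `|h t - k| <= q.
  have /andP[] := fh t; have /andP[] := fh 0; rewrite /= h0 => *.
  by rewrite /k ler_norml; apply/andP; split; lra.
have := trh i t ti; have := short (h t - k) (phi k x) kh.
rewrite -(flowD phi_flow) subrK.
by have := metric_triangle (phi (t - jump_time P i) (P i).1) (phi (h t) x) (phi k x); lra.
Qed.
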